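(* Let $q$ be a prime power, let $\ell\ge 0$ and $n>1$ be integers. For $\vec{c}=(c_1,\ldots,c_{\ell})\in\mathbb{F}_q^{\ell}$ we have \begin{align*} S_{q}(n;\vec{c}) &=\frac{1}{2}\sum_{\vec{a}\in \mathbb{F}_{q}^{\ell}}[\![\psi_{(1,\vec{a})}(\vec{a})=\vec{c}]\!]\, S_q(n/2;\vec{a}) +I_q\big(n;\phi_n^{-1}(\vec{c})\big)-\frac{1}{2}\sum_{\substack{\vec{b}=(b_0,\ldots,b_\ell)\in \mathbb{F}_{q}^{\ell+1}\\ b_0\neq 0}} I_q\big(n;\psi^{-1}_{\vec{b}}(\vec{c}),\vec{b}\big), \end{align*} where $(1,\vec a)$ denotes the vector $(1,a_1,\ldots,a_\ell)\in\mathbb{F}_q^{\ell+1}$.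
   Context: $\mathbb{F}_q$ is the finite field with $q$ elements, of characteristic $p$. A monic polynomial $f\in\mathbb{F}_q[x]$ is self-reciprocal if $x^{\deg f}f(1/x)=f(x)$. $[\![P]\!]$ is $1$ if $P$ is true and $0$ otherwise. For integers $d\ge1$, $\ell,t\ge 0$, $\vec a=(a_1,\ldots,a_\ell)\in\mathbb{F}_q^\ell$ and $\vec b=(b_0,\ldots,b_{t-1})\in\mathbb{F}_q^{t}$, $I_q(d;\vec a,\vec b)$ is the number of monic irreducible $f\in\mathbb{F}_q[x]$ of degree $d$ with $[x^{d-j}]f=a_j$ for $1\le j\le \ell$ and $[x^j]f=b_j$ for $0\le j\le t-1$; $I_q(d;\vec a)$ is the same with no condition on the low-order coefficients ($t=0$). $S_q(n;\vec a)$ is the number of self-reciprocal monic irreducible $f\in\mathbb{F}_q[x]$ of degree $2n$ with $[x^{2n-j}]f=a_j$ for $1\le j\le\ell$; by convention $S_q(n/2;\vec a)=0$ when $n$ is odd. $\phi_n:\mathbb{F}_q^\ell\to\mathbb{F}_q^\ell$ is the bijection $(g_1,\ldots,g_\ell)\mapsto(f_1,\ldots,f_\ell)$ given by $f_k=\sum_{0\le j\le k/2}\binom{n+2j-k}{j}g_{k-2j}$ for $1\le k\le \ell$, where $g_0=1$ and the binomial coefficients are taken in $\mathbb{F}_q$. (This records the relation between the coefficients $g_k=[x^{n-k}]g$ of a monic $g$ of degree $n$ and $f_k=[x^{2n-k}]f$ where $f(x)=x^ng(x+1/x)$.) For $\vec b=(b_0,b_1,\ldots,b_\ell)\in\mathbb{F}_q^{\ell+1}$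 with $b_0\ne0$, $\psi_{\vec b}:\mathbb{F}_q^\ell\to\mathbb{F}_q^\ell$ is the bijection $\vec a\mapsto\vec c$ with $c_k=a_k+b_0^{-1}b_k+b_0^{-1}\sum_{j=1}^{k-1}a_jb_{k-j}$ for $1\le k\le\ell$; $\phi_n^{-1},\psi_{\vec b}^{-1}$ denote the inverse maps. *)

(* Defs.v *)
From HB Require Import structures.
From mathcomp Require Import all_boot all_order all_algebra all_field.
From mathcomp Require Import boolp.
Set Implicit Arguments. Unset Strict Implicit. Unset Printing Implicit Defensive.
Import GRing.Theory.
Local Open Scope ring_scope.

Section Defs.
Variable F : finFieldType.

Definition mkmonic (d : nat) (u : {ffun 'I_d -> F}) : {poly F} :=
  'X^d + \sum_(i < d) u i *: 'X^i.

Definition recip (f : {poly F}) : {poly F} :=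
  \poly_(i < size f) f`_((size f).-1 - i).

Definition self_reciprocal (f : {poly F}) : bool := recip f == f.

Definition topc (f : {poly F}) (d j : nat) : F :=
  if (j <= d)%N then f`_(d - j) else 0.

(* Vectors (a_1,...,a_l) are stored as a : {ffun 'I_l -> F}, a_k = a (k-1).
   get a k returns a_k for 1 <= k <= l and 0 otherwise. *)
Definition get (l : nat) (a : {ffun 'I_l -> F}) (k : nat) : F :=
  if insub k.-1 is Some i then (if (0 < k)%N then a i else 0) else 0.

(* Vectors (b_0,...,b_l) are stored as b : {ffun 'I_l.+1 -> F}, b_j = b j. *)
Definition getb (m : nat) (b : {ffun 'I_m -> F}) (j : nat) : F :=
  if insub j is Some i then b i else 0.

Definition Icount2 (d l t : nat) (a : {ffun 'I_l -> F}) (b : {ffun 'I_t -> F}) : nat :=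
  #|[set u : {ffun 'I_d -> F} |
      `[< irreducible_poly (mkmonic u) >]
      && [forall i : 'I_l, topc (mkmonic u) d i.+1 == a i]
      && [forall j : 'I_t, (mkmonic u)`_j == b j]]|.

Definition Icount (d l : nat) (a : {ffun 'I_l -> F}) : nat :=
  #|[set u : {ffun 'I_d -> F} |
      `[< irreducible_poly (mkmonic u) >]
      && [forall i : 'I_l, topc (mkmonic u) d i.+1 == a i]]|.

Definition Scount (n l : nat) (a : {ffun 'I_l -> F}) : nat :=
  #|[set u : {ffun 'I_(n.*2) -> F} |
      self_reciprocal (mkmonic u)
      && `[< irreducible_poly (mkmonic u) >]
      && [forall i : 'I_l, topc (mkmonic u) n.*2 i.+1 == a i]]|.

Definition Shalf (n l : nat) (a : {ffun 'I_l -> F}) : nat :=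
  if odd n then 0%N else Scount n./2 a.

Definition gg (l : nat) (g : {ffun 'I_l -> F}) (m : nat) : F :=
  if m == 0%N then 1 else get g m.

Definition phi (n l : nat) (g : {ffun 'I_l -> F}) : {ffun 'I_l -> F} :=
  [ffun i : 'I_l => let k := i.+1 in
     \sum_(j < k./2.+1) ('C(n + 2 * j - k, j))%:R * gg g (k - 2 * j)].

Definition psi (l : nat) (b : {ffun 'I_l.+1 -> F}) (a : {ffun 'I_l -> F}) :
  {ffun 'I_l -> F} :=
  [ffun i : 'I_l => let k := i.+1 in
     get a k + (b ord0)^-1 * getb b k
     + (b ord0)^-1 * \sum_(1 <= j < k) get a j * getb b (k - j)].

(* inverse maps: the (unique) preimage *)
Definition phiinv (n l : nat) (c : {ffun 'I_l -> F}) : {ffun 'I_l -> F} :=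
  odflt c [pick g | phi n g == c].

Definition psiinv (l : nat) (b : {ffun 'I_l.+1 -> F}) (c : {ffun 'I_l -> F}) :
  {ffun 'I_l -> F} :=
  odflt c [pick a | psi b a == c].

Definition cons1 (l : nat) (a : {ffun 'I_l -> F}) : {ffun 'I_l.+1 -> F} :=
  [ffun j : 'I_l.+1 => if j == ord0 then 1 else get a j].

End Defs.

(* Main.v *)
(* A monic f of degree 2n is self-reciprocal exactly when f = x^n g(x + 1/x) for a unique monic g of
   degree n, and g -> f is multiplicative.  If f is irreducible then so is g.  Conversely, for g
   irreducible of degree n > 1, either f is irreducible or f = h h~ with h irreducible of degree n
   and h <> h~, where h~ = x^n h(1/x) / h(0); then the unordered pair {h, h~} is determined by g.
   Hence #{g} = #{f irreducible} + (#{h} - #{h : h = h~}) / 2.  An irreducible h of degree n > 1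
   with h = h~ has even degree and h(0) = 1, so it is itself self-reciprocal and h h~ = h^2.
   The leading coefficients of f are read off those of g through phi, and those of h h~ off both
   ends of h through psi. *)
Require Import Defs.
From HB Require Import structures.
From mathcomp Require Import all_boot all_order all_algebra all_field.
From mathcomp Require Import zify ring lra.
From mathcomp Require Import boolp.
Import GRing.Theory.
Local Open Scope ring_scope.
Set Implicit Arguments. Unset Strict Implicit. Unset Printing Implicit Defensive.

(** * Homogenization, reversal, and the lift of g to x^n g(x + 1/x) *)

Section Homogenization.
Variable F : fieldType.
Implicit Types (f g h p q r u v : {poly F}) (m n k d : nat).

(* [u^m f(v/u)] without denominators, for [f] of degree at most [m]. *)
Definition homog m u v f : {poly F} :=
  \sum_(i < m.+1) f`_i *: (u ^+ (m - i) * v ^+ i).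

Fact homog_is_linear m u v : linear (homog m u v).
Proof.
move=> a f g; rewrite /homog scaler_sumr -big_split /=.
by apply: eq_bigr => i _; rewrite coefD coefZ scalerA -scalerDl.
Qed.
HB.instance Definition _ m u v :=
  GRing.isLinear.Build F {poly F} {poly F} _ (homog m u v) (homog_is_linear m u v).

Lemma homogXn m u v k : (k <= m)%N -> homog m u v 'X^k = u ^+ (m - k) * v ^+ k.
Proof.
move=> lekm; rewrite /homog (bigD1 (Ordinal (lekm : (k < m.+1)%N))) //=.
rewrite coefXn eqxx scale1r big1 ?addr0 // => i neq_ik.
by rewrite coefXn -[_ == k]/(i == Ordinal (lekm : (k < m.+1)%N)) (negbTE neq_ik) scale0r.
Qed.

Lemma poly_wide m f : (size f <= m.+1)%N -> f = \sum_(i < m.+1) f`_i *: 'X^i.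
Proof.
move=> sz_f; rewrite -poly_def; apply/polyP => i; rewrite coef_poly.
by case: ltnP => // le_mi; rewrite nth_default // (leq_trans sz_f).
Qed.

(** By bilinearity it suffices to check monomials. Reversal and the lift both inherit
    multiplicativity from this, as long as the degree bounds add up. *)
Lemma homogM m k u v f g : (size f <= m.+1)%N -> (size g <= k.+1)%N ->
  homog (m + k) u v (f * g) = homog m u v f * homog k u v g.
Proof.
move=> /poly_wide{1}-> /poly_wide{1}->.
rewrite /homog !big_distrlr /= -/(homog _ _ _ _) linear_sum; apply: eq_bigr => i _.
rewrite linear_sum; apply: eq_bigr => j _ /=.
rewrite -scalerAl -scalerAr -exprD !linearZ /= homogXn ?leq_add ?leq_ord //.
have -> : (m + k - (i + j) = (m - i) + (k - j))%N by have := leq_ord i; have := leq_ord j; lia.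
rewrite -!scalerAl -!scalerAr !exprD; congr (_ *: (_ *: _)); ring.
Qed.

(* [x^m f(1/x)] *)
Definition revp m := homog m 'X 1.
HB.instance Definition _ m := GRing.Linear.on (revp m).

Lemma coef_revp m f i : (revp m f)`_i = if (i <= m)%N then f`_(m - i) else 0.
Proof.
rewrite /revp /homog (reindex_inj rev_ord_inj) /=.
under eq_bigr => j _ do rewrite expr1n mulr1 subSS subKn ?leq_ord //.
by rewrite -(poly_def _ (fun j => f`_(m - j))) coef_poly.
Qed.

Lemma size_revp m f : (size (revp m f) <= m.+1)%N.
Proof. by apply/leq_sizeP => j lt_mj; rewrite coef_revp leqNgt lt_mj. Qed.

Lemma revpK m f : (size f <= m.+1)%N -> revp m (revp m f) = f.
Proof.
move=> sz_f; apply/polyP => i; rewrite !coef_revp leq_subr.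
by case: leqP => [/subKn-> //|lt_mi]; rewrite nth_default // (leq_trans sz_f).
Qed.

Lemma revpM m k f g : (size f <= m.+1)%N -> (size g <= k.+1)%N ->
  revp (m + k) (f * g) = revp m f * revp k g.
Proof. exact: homogM. Qed.

Lemma revpX : revp 2 ('X : {poly F}) = 'X.
Proof. by rewrite -['X]expr1 /revp homogXn // expr1n mulr1. Qed.

Lemma revpX21 : revp 2 ('X^2 + 1 : {poly F}) = 'X^2 + 1.
Proof.
rewrite -{1}(expr0 'X) linearD /= /revp !homogXn // !expr1n !mulr1 subnn expr0.
by rewrite addrC.
Qed.

Lemma revp01 : revp 0 (1 : {poly F}) = 1.
Proof. by rewrite -{1}(expr0 'X) /revp homogXn // expr0 mulr1. Qed.

(* [x^n f(x + 1/x)] *)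
Definition srlift n := homog n 'X ('X^2 + 1).
HB.instance Definition _ n := GRing.Linear.on (srlift n).

(** Separating the top coefficient of [f] gives the recursion behind the inductions on [n] below;
    [srlift n f] on the right ignores that coefficient. *)
Lemma srliftS n f : srlift n.+1 f = 'X * srlift n f + f`_n.+1 *: ('X^2 + 1) ^+ n.+1.
Proof.
rewrite /srlift /homog big_ord_recr /= subnn expr0 mul1r; congr (_ + _).
rewrite mulr_sumr; apply: eq_bigr => i _; rewrite subSn ?leq_ord // exprS.
by rewrite -scalerAr mulrA.
Qed.

Lemma srlift0 f : srlift 0 f = (f`_0)%:P.
Proof. by rewrite /srlift /homog big_ord1 !expr0 mulr1 alg_polyC. Qed.

Lemma srliftM m k f g : (size f <= m.+1)%N -> (size g <= k.+1)%N ->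
  srlift (m + k) (f * g) = srlift m f * srlift k g.
Proof. exact: homogM. Qed.

Lemma size_X21 n : size (('X^2 + 1 : {poly F}) ^+ n) = n.*2.+1.
Proof.
have sz2 : size ('X^2 + 1 : {poly F}) = 3 by rewrite size_polyDl size_polyXn ?size_poly1.
rewrite -(prednK (n := size _)) ?size_exp ?sz2 ?mul2n //.
by rewrite size_poly_gt0 expf_neq0 // -size_poly_gt0 sz2.
Qed.

Lemma revp_X21 n : revp n.*2 (('X^2 + 1) ^+ n) = ('X^2 + 1 : {poly F}) ^+ n.
Proof.
elim: n => [|n IHn]; first by rewrite expr0 revp01.
rewrite exprS doubleS -[n.*2.+2]/(2 + n.*2)%N revpM ?revpX21 ?IHn ?size_X21 //.
by have := size_X21 1; rewrite expr1 => ->.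
Qed.

Lemma size_srlift n f : (size (srlift n f) <= n.*2.+1)%N.
Proof.
elim: n => [|n IHn]; first by rewrite srlift0 size_polyC leq_b1.
rewrite srliftS (leq_trans (size_polyD _ _)) // geq_max.
rewrite (leq_trans (size_scale_leq _ _)) ?size_X21 // andbT.
by rewrite (leq_trans (size_polyMleq _ _)) // size_polyX /= doubleS !ltnS leqW.
Qed.

Lemma revp_srlift n f : revp n.*2 (srlift n f) = srlift n f.
Proof.
elim: n => [|n IHn].
  by rewrite srlift0 -[_%:P]mulr1 mul_polyC linearZ /= revp01.
rewrite srliftS linearD linearZ /= revp_X21 doubleS -[n.*2.+2]/(2 + n.*2)%N.
by rewrite revpM ?size_srlift ?size_polyX // revpX IHn.
Qed.

Lemma coef_sym m f i : revp m f = f -> (i <= m)%N -> f`_(m - i) = f`_i.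
Proof. by move=> {2}<- le_im; rewrite coef_revp le_im. Qed.

Lemma srlift_coef0 n f : (srlift n f)`_0 = f`_n.
Proof.
case: n => [|n]; first by rewrite srlift0 coefC.
rewrite srliftS coefD coefXM coefZ add0r -horner_coef0 !hornerE.
by rewrite expr0n /= add0r expr1n mulr1.
Qed.

(** The constant term of the lift is the coefficient of index [n]. Once these agree, [srliftS]
    allows the top terms to be cancelled and a factor X to be divided out. *)
Lemma srlift_inj n f g : (size f <= n.+1)%N -> (size g <= n.+1)%N ->
  srlift n f = srlift n g -> f = g.
Proof.
move=> sz_f sz_g eq_fg.
suff E i : (i <= n)%N -> f`_i = g`_i.
  apply/polyP => i; case: (leqP i n) => [/E//|lt_ni].
  by rewrite !nth_default // (leq_trans _ lt_ni).
elim: n {sz_f sz_g} eq_fg i => [|n IHn] eq_fg i.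
  by rewrite leqn0 => /eqP->; move/(congr1 (coefp 0)): eq_fg; rewrite /= !srlift_coef0.
have En : f`_n.+1 = g`_n.+1 by rewrite -(srlift_coef0 _ f) eq_fg srlift_coef0.
rewrite leq_eqVlt => /predU1P[->//|]; rewrite ltnS; apply: IHn.
by move: eq_fg; rewrite !srliftS En => /addIr/mulfI; apply; rewrite polyX_eq0.
Qed.

Lemma srlift_trunc n f (c : F) : srlift n (f + c *: 'X^(n.+1)) = srlift n f.
Proof.
apply: eq_bigr => i _; congr (_ *: _).
by rewrite coefD coefZ coefXn ltn_eqF // mulr0 addr0.
Qed.

(** Subtracting c (X^2 + 1)^(n+1), with [c] the coefficient of index 2n + 2, kills that coefficient
    and, by symmetry, the constant term too. The remainder is X times a symmetric polynomial for the
    bound 2n. *)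
Lemma srlift_surj n f : (size f <= n.*2.+1)%N -> revp n.*2 f = f ->
  exists2 g : {poly F}, (size g <= n.+1)%N & srlift n g = f.
Proof.
elim: n f => [|n IHn] f sz_f sym_f.
  by exists f => //; rewrite srlift0 -size1_polyC.
set c := f`_n.*2.+2; pose r := f - c *: ('X^2 + 1) ^+ n.+1.
have sym_r : revp n.*2.+2 r = r.
  by rewrite linearB linearZ /= -doubleS revp_X21 sym_f.
have r0 : r`_0 = 0.
  rewrite coefB coefZ -(horner_coef0 (_ ^+ _)) !hornerE expr0n add0r expr1n mulr1.
  by rewrite -(coef_sym sym_f (leq0n _)) subn0 subrr.
have sz_r : (size r <= n.*2.+2)%N.
  apply/leq_sizeP => j; rewrite leq_eqVlt => /predU1P[<-|lt_nj].
    by rewrite -[n.*2.+2]subn0 (coef_sym sym_r).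
  by rewrite -sym_r coef_revp leqNgt lt_nj.
have [r' Er] : exists r', r = 'X * r'.
  have : 'X - 0%:P %| r by rewrite dvdp_XsubCl /root horner_coef0 r0.
  by rewrite subr0 => /dvdpP[r' ->]; exists r'; rewrite mulrC.
have sz_r' : (size r' <= n.*2.+1)%N.
  have [->|r'0] := eqVneq r' 0; first by rewrite size_poly0.
  by move: sz_r; rewrite Er mulrC size_mulX.
case: (IHn r') => // [|g sz_g Eg].
  apply: (@mulfI _ 'X); rewrite ?polyX_eq0 //.
  by rewrite -{1}revpX -revpM ?size_polyX // -Er.
exists (g + c *: 'X^(n.+1)).
  rewrite (leq_trans (size_polyD _ _)) // geq_max leqW //=.
  by rewrite (leq_trans (size_scale_leq _ _)) ?size_polyXn.
rewrite srliftS srlift_trunc Eg -Er coefD coefZ coefXn eqxx mulr1.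
by rewrite [g`__]nth_default // add0r /r subrK.
Qed.

Lemma size_monic n f : (size f <= n.+1)%N -> f`_n = 1 -> ((f \is monic) * (size f = n.+1))%type.
Proof.
move=> sz_f fn; have sz : size f = n.+1.
  apply/eqP; rewrite eqn_leq sz_f ltnNge; apply/negP.
  by move=> /leq_sizeP/(_ n (leqnn _))/eqP; rewrite fn oner_eq0.
by split=> //; rewrite monicE /lead_coef sz fn.
Qed.

Lemma monic_coef n f : f \is monic -> size f = n.+1 -> f`_n = 1.
Proof. by move=> /monicP; rewrite /lead_coef => + sz; rewrite sz. Qed.

Lemma srlift_monic n g : g \is monic -> size g = n.+1 ->
  ((srlift n g \is monic) * (size (srlift n g) = n.*2.+1))%type.
Proof.
move=> mg sg; apply: size_monic; rewrite ?size_srlift //.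
rewrite -(coef_sym (revp_srlift n g)) // subnn srlift_coef0; exact: monic_coef.
Qed.

(** By symmetry the coefficient of index 2n equals the constant one, g_n, which is nonzero. This
    form serves for factors of g that need not be monic. *)
Lemma size_srliftE n g : size g = n.+1 -> size (srlift n g) = n.*2.+1.
Proof.
move=> sg; apply/eqP; rewrite eqn_leq size_srlift ltnNge; apply/negP.
move=> /leq_sizeP/(_ n.*2 (leqnn _)).
rewrite -(coef_sym (revp_srlift n g)) // subnn srlift_coef0.
have := lead_coef_eq0 g; rewrite /lead_coef sg /= => + E; rewrite E eqxx => /esym/eqP g0.
by rewrite g0 size_poly0 in sg.
Qed.

Lemma srlift_monic_surj n f : f \is monic -> size f = n.*2.+1 -> revp n.*2 f = f ->
  exists2 g : {poly F}, ((g \is monic) * (size g = n.+1))%type & srlift n g = f.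
Proof.
move=> mf sf sym_f; have [|g sg Eg] := srlift_surj _ sym_f; first by rewrite sf.
exists g => //; apply: size_monic => //.
by rewrite -(srlift_coef0 n g) Eg -(coef_sym sym_f (leq0n _)) subn0 (monic_coef mf).
Qed.

Lemma horner_srlift n g a : a != 0 -> (size g <= n.+1)%N ->
  (srlift n g).[a] = a ^+ n * g.[(a ^+ 2 + 1) / a].
Proof.
move=> a0 sg; rewrite (horner_coef_wide _ sg) horner_sum mulr_sumr.
apply: eq_bigr => i _; rewrite !hornerE exprMn exprVn.
have -> : a ^+ n = a ^+ (n - i) * a ^+ i by rewrite -exprD subnK ?leq_ord.
have := expf_neq0 i a0; move: (a ^+ i) => b b0.
by rewrite /=; field.
Qed.

End Homogenization.

(** * Reciprocal pairs and the factorization of lifts *)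

Section Reciprocal.
Variable F : fieldType.
Implicit Types (f g h p q r u v : {poly F}) (m n k d : nat).

(* The library states these facts for [F] seen as an integral domain, which [lia] does not
   identify with [F] seen as a field. *)
Fact size_fmul p q : p != 0 -> q != 0 -> size (p * q) = (size p + size q).-1.
Proof. exact: size_mul. Qed.

Fact size_fgt0 p : (0 < size p)%N = (p != 0).
Proof. exact: size_poly_gt0. Qed.

Fact eqp_fsize p q : p %= q -> size p = size q.
Proof. exact: eqp_size. Qed.

Fact dvdp_fleq p q : q != 0 -> p %| q -> (size p <= size q)%N.
Proof. exact: dvdp_leq. Qed.

Fact irr_fsize p : irreducible_poly p -> (1 < size p)%N.
Proof. by case. Qed.

Lemma irreducible_mulP p : irreducible_poly p <->
  (1 < size p)%N /\ forall q r, p = q * r -> size q = 1%N \/ size r = 1%N.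
Proof.
split=> [irr_p|[sz_p fact_p]].
  split=> [|q r Ep]; [exact: irr_p.1 | have p0 := irredp_neq0 irr_p].
  have [/eqP|sz_q] := boolP (size q == 1%N); [by left | right].
  have := irr_p.2 _ sz_q; rewrite Ep dvdp_mulr // => /(_ isT)/eqp_fsize sz.
  move: p0; rewrite Ep mulf_eq0 negb_or => /andP[q0 r0].
  by rewrite size_fmul // in sz; move: sz q0 r0; rewrite -!size_fgt0; lia.
split=> // q sz_q /dvdpP[r Er].
have [/eqP/size_poly1P[c c0 Ec]|sz_q1] := fact_p _ _ Er; last by rewrite sz_q1 in sz_q.
by rewrite Er Ec mul_polyC eqp_sym eqp_scale.
Qed.

Lemma irreducible_dvdM p q r : irreducible_poly p -> p %| q * r -> (p %| q) || (p %| r).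
Proof.
move=> irr_p pqr; case: (boolP (p %| q)) => //= npq.
by rewrite -(@Gauss_dvdpr _ _ q) // irreducible_poly_coprime.
Qed.

Lemma irreducible_monic_dvd p q : irreducible_poly p -> p \is monic ->
  irreducible_poly q -> q \is monic -> p %| q -> p = q.
Proof.
move=> irr_p mp irr_q mq pq; apply/eqP; rewrite -eqp_monic // irr_q //.
by rewrite gtn_eqF // irr_p.
Qed.

Lemma irreducible_factor f : (1 < size f)%N ->
  exists h, [/\ irreducible_poly h, h \is monic & h %| f].
Proof.
have [m] := ubnP (size f); elim: m f => // m IHm f lt_fm sz_f.
have [irr_f|nirr] := pselect (irreducible_poly f).
  have f0 := irredp_neq0 irr_f; have lf0 : (lead_coef f)^-1 != 0 by rewrite invr_eq0 lead_coef_eq0.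
  exists ((lead_coef f)^-1 *: f); split; last by rewrite dvdpZl.
    split=> [|q sz_q]; first by rewrite size_scale ?irr_f.
    by rewrite dvdpZr // => /(irr_f.2 _ sz_q) qf; rewrite (eqp_trans qf) // eqp_sym eqp_scale.
  by rewrite monicE lead_coefZ mulVf // lead_coef_eq0.
have [q [r [Ef sz_q sz_r]]] : exists q r, [/\ f = q * r, size q != 1%N & size r != 1%N].
  apply: contrapT => nex; apply: nirr; apply/irreducible_mulP; split=> // q r Ef.
  apply: contrapT => /not_orP[/eqP sq /eqP sr]; apply: nex; by exists q, r.
have : f != 0 by rewrite -size_fgt0 ltnW.
rewrite Ef mulf_eq0 negb_or => /andP[q0 r0].
rewrite -size_fgt0 in q0; rewrite -size_fgt0 in r0.
have sz : size f = (size q + size r).-1 by rewrite Ef size_fmul -?size_fgt0.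
have [||h [irr_h mh hq]] := IHm q; [lia | lia |].
by exists h; split; rewrite // dvdp_mulr.
Qed.

(** This is h~; dividing by h(0), when nonzero, makes the reversal monic. *)
Definition mrevp n h := (h`_0)^-1 *: revp n h.

Lemma size_revp_neq0 n f : f`_0 != 0 -> size (revp n f) = n.+1.
Proof.
move=> f0; apply/eqP; rewrite eqn_leq size_revp ltnNge; apply/negP.
by move=> /leq_sizeP/(_ n (leqnn _))/eqP; rewrite coef_revp leqnn subnn (negbTE f0).
Qed.

Section Tilde.
Variables (n : nat) (h : {poly F}).
Hypotheses (mh : h \is monic) (sh : size h = n.+1) (h0 : h`_0 != 0).

Lemma mrevp_coef0 : (mrevp n h)`_0 = (h`_0)^-1.
Proof. by rewrite coefZ coef_revp subn0 leq0n (monic_coef mh sh) mulr1. Qed.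

Lemma mrevp_coef0_neq0 : (mrevp n h)`_0 != 0.
Proof. by rewrite mrevp_coef0 invr_eq0. Qed.

Lemma mrevp_monic : ((mrevp n h \is monic) * (size (mrevp n h) = n.+1))%type.
Proof.
apply: size_monic; first exact: leq_trans (size_scale_leq _ _) (size_revp _ _).
by rewrite coefZ coef_revp leqnn subnn mulVf.
Qed.

Lemma revp_mrevp : revp n (mrevp n h) = (h`_0)^-1 *: h.
Proof. by rewrite linearZ /= revpK ?sh. Qed.

Lemma mrevpK : mrevp n (mrevp n h) = h.
Proof. by rewrite /mrevp -/(mrevp n h) mrevp_coef0 revp_mrevp scalerA invrK mulfV ?scale1r. Qed.

(** Reversing a factorization of h~ gives one of h up to a scalar. As h~(0) is nonzero, so are the
    constant terms of the factors, and reversal preserves their sizes. *)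
Lemma mrevp_irreducible : irreducible_poly h -> irreducible_poly (mrevp n h).
Proof.
move=> /irreducible_mulP[sz_h fact_h]; apply/irreducible_mulP.
rewrite mrevp_monic -sh; split=> // q r Eqr.
have := mrevp_coef0_neq0; rewrite Eqr coef0M mulf_eq0 negb_or => /andP[q0 r0].
have qn0 : q != 0 by apply: contraNneq q0 => ->; rewrite coef0.
have rn0 : r != 0 by apply: contraNneq r0 => ->; rewrite coef0.
have := mrevp_monic.2; rewrite Eqr size_fmul // => sz.
move: qn0 rn0; rewrite -!size_fgt0 => qn0 rn0.
have := revp_mrevp; rewrite Eqr.
have -> : n = ((size q).-1 + (size r).-1)%N by lia.
rewrite revpM ?prednK // => /(congr1 (fun p => h`_0 *: p)).
rewrite scalerA mulfV // scale1r scalerAl => /esym/fact_h.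
by rewrite size_scale // !size_revp_neq0 // !prednK.
Qed.

Lemma mul_mrevp : [/\ h * mrevp n h \is monic, size (h * mrevp n h) = n.*2.+1
  & revp n.*2 (h * mrevp n h) = h * mrevp n h].
Proof.
split; first by rewrite monicMl // mrevp_monic.
  by rewrite size_fmul ?monic_neq0 ?mrevp_monic // sh; lia.
rewrite -addnn revpM ?sh ?mrevp_monic // revp_mrevp /mrevp -!scalerAr; congr (_ *: _).
exact: mulrC.
Qed.

(** Reversing p = e h exhibits the reversal of h as a divisor of p. *)
Lemma mrevp_dvd m p : h %| p -> revp m p = p -> (size p <= m.+1)%N -> mrevp n h %| p.
Proof.
have [->|p0] := eqVneq p 0; first by rewrite dvdp0.
move=> /dvdpP[e Ee] sym_p sz_p.
have en0 : e != 0 by apply: contraNneq p0 => e0; rewrite Ee e0 mul0r.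
have hn0 : h != 0 by apply: monic_neq0.
have := sz_p; rewrite Ee size_fmul // sh; move: (en0); rewrite -size_fgt0 => en0' sz.
rewrite -Ee -sym_p Ee (_ : m = (m - n) + n)%N; last by lia.
rewrite revpM ?sh //; last by lia.
by rewrite dvdp_mull // dvdpZl ?invr_eq0.
Qed.

End Tilde.

(** The coefficients at i and n - i agree, while (-1)^i and (-1)^(n-i) are opposite. *)
Lemma odd_sym_root n h : odd n -> (size h <= n.+1)%N -> revp n h = h -> h.[-1] = 0.
Proof.
move=> odd_n sz_h sym_h; have [m En] : exists m, n.+1 = (m + m)%N.
  by exists n.+1./2; rewrite addnn even_halfK //= odd_n.
(* With n + 1 = 2m, position m - (i + 1) of the lower half mirrors position m + i of the upper
   half. *)
rewrite (horner_coef_wide _ sz_h) En big_split_ord /= (reindex_inj rev_ord_inj) /=.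
rewrite -big_split big1 //= => i _; have lt_im := ltn_ord i.
rewrite -(coef_sym sym_h (i := m - i.+1)); last by lia.
have -> : (n - (m - i.+1) = m + i)%N by lia.
rewrite -mulrDr [in X in _ * X]exprD.
have -> : (-1 : F) ^+ (m - i.+1) = - (-1) ^+ (m + i).
  rewrite -(signr_odd _ (m - i.+1)) -(signr_odd _ (m + i)).
  have -> : odd (m - i.+1) = ~~ odd (m + i) by rewrite oddB // oddD /= -addbN.
  by case: (odd _); rewrite /= ?expr0 ?expr1 ?opprK.
by rewrite -exprD addNr mulr0.
Qed.

Lemma irreducible_root n h a : irreducible_poly h -> size h = n.+1 -> (1 < n)%N -> h.[a] != 0.
Proof.
move=> irr_h sh lt1n; apply/negP => h_a.
have := irr_h.2 ('X - a%:P); rewrite size_XsubC dvdp_XsubCl => /(_ isT h_a)/eqp_fsize.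
by rewrite size_XsubC sh; lia.
Qed.

Lemma irreducible_coef0 n h : irreducible_poly h -> size h = n.+1 -> (1 < n)%N -> h`_0 != 0.
Proof. by move=> irr_h sh lt1n; rewrite -horner_coef0 (irreducible_root _ irr_h sh). Qed.

(** Evaluating the reversal at 1 gives h(1) = h(0) h(1) with h(1) nonzero, so h(0) = 1. An odd
    degree would then make -1 a root. *)
Lemma mrevp_fixed n h : irreducible_poly h -> h \is monic -> size h = n.+1 ->
  (1 < n)%N -> mrevp n h = h -> revp n h = h /\ ~~ odd n.
Proof.
move=> irr_h mh sh lt1n fix_h; have h0 := irreducible_coef0 irr_h sh lt1n.
have Erev : revp n h = h`_0 *: h by rewrite -{3}fix_h scalerA mulfV // scale1r.
suff h01 : h`_0 = 1.
  have sym_h : revp n h = h by rewrite Erev h01 scale1r.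
  split=> //; apply/negP => odd_n.
  have := irreducible_root (-1) irr_h sh lt1n.
  by rewrite (odd_sym_root odd_n) ?eqxx ?sh.
apply: (mulIf (irreducible_root 1 irr_h sh lt1n)); rewrite mul1r.
rewrite -hornerZ -Erev /revp /homog horner_sum (@horner_coef_wide _ n.+1) ?sh //.
by apply: eq_bigr => i _; rewrite !hornerE !expr1n /= !mulr1.
Qed.

Lemma size_pos_pred q : q != 0 -> exists k, size q = k.+1.
Proof. by rewrite -size_fgt0 => /prednK <-; exists (size q).-1. Qed.

(** A factorization of g lifts to one of [srlift n g] with all degrees doubled. *)
Lemma srlift_irreducible_imp n g : (0 < n)%N -> size g = n.+1 ->
  irreducible_poly (srlift n g) -> irreducible_poly g.
Proof.
move=> n_gt0 sg /irreducible_mulP[_ fact]; apply/irreducible_mulP.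
rewrite sg; split=> [//|q r Eg].
have : g != 0 by rewrite -size_fgt0 sg.
rewrite Eg mulf_eq0 negb_or => /andP[/[dup] q0 /size_pos_pred[k sq] /[dup] r0 /size_pos_pred[m sr]].
have En : n = (k + m)%N by move: sg; rewrite Eg size_fmul // sq sr; lia.
have := fact (srlift k q) (srlift m r).
rewrite En Eg srliftM ?sq ?sr // => /(_ erefl).
by rewrite !size_srliftE //; lia.
Qed.

(* [p] and its cofactor are both symmetric of even degree, hence images of factors of [g]. *)
Lemma srlift_sym_factor n g k p : irreducible_poly g -> g \is monic -> size g = n.+1 ->
  p \is monic -> size p = k.*2.+1 -> revp k.*2 p = p -> (0 < k)%N ->
  p %| srlift n g -> p = srlift n g.
Proof.
move=> irr_g mg sg mp sp sym_p k_gt0 /dvdpP[e Ee].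
have [ml sl] := srlift_monic mg sg.
have me : e \is monic by rewrite -(monicMl e mp) mulrC -Ee.
have [j se] := size_pos_pred (monic_neq0 me).
have sz : (n.*2 = k.*2 + j)%N by move: sl; rewrite Ee size_fmul ?monic_neq0 // se sp; lia.
have [m Em] : exists m, j = m.*2 by exists (n - k)%N; lia.
have sym_e : revp j e = e.
  have := revp_srlift n g; rewrite Ee sz addnC revpM ?se ?sp // sym_p.
  by apply: mulIf; rewrite monic_neq0.
move: sym_e se; rewrite Em => sym_e se.
have [q [mq sq] Eq] := srlift_monic_surj mp sp sym_p.
have [r [mr sr] Er] := srlift_monic_surj me se sym_e.
have En : n = (m + k)%N by lia.
have Eg : g = r * q.
  apply: (@srlift_inj _ n); rewrite ?sg ?size_fmul ?monic_neq0 ?sr ?sq; try lia.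
  by rewrite {2}En srliftM ?sr ?sq // Er Eq.
case/irreducible_mulP: irr_g => _ /(_ _ _ Eg); rewrite sr sq.
case=> [[m0]|]; last by lia.
have /eqP/size_poly1P[c c0 Ec] : size e = 1%N by rewrite se m0.
by move: me; rewrite Ec monicE lead_coefC => /eqP c1; rewrite Ee Ec c1 mul1r.
Qed.

(** If g is a product, h divides the lift of one of the two factors, and this factor must already
    have full degree n. *)
Lemma srlift_mul_mrevp_irreducible n g h : (0 < n)%N -> size g = n.+1 ->
  irreducible_poly h -> h \is monic -> size h = n.+1 -> h`_0 != 0 -> mrevp n h != h ->
  srlift n g = h * mrevp n h -> irreducible_poly g.
Proof.
move=> n_gt0 sg irr_h mh sh h0 ntl Eg; apply/irreducible_mulP.
rewrite sg; split=> // q r Eqr.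
have gn0 : g != 0 by rewrite -size_fgt0 sg.
have irr_t := mrevp_irreducible mh sh h0 irr_h.
(* The lift of [q'] is symmetric, so h~ divides it as well. Since h and h~ are coprime, h h~ of
   degree 2n divides it, which leaves degree 0 for [r']. *)
have big q' r' : g = q' * r' -> h %| srlift (size q').-1 q' -> size r' = 1%N.
  move=> Eg' h_dvd; move: gn0; rewrite Eg' mulf_eq0 negb_or.
  case/andP=> [/[dup] q0 /size_pos_pred[k sq] /[dup] r0 /size_pos_pred[m sr]].
  have En : n = (k + m)%N by move: sg; rewrite Eg' size_fmul // sq sr; lia.
  rewrite sq /= in h_dvd.
  have t_dvd := mrevp_dvd mh sh h0 h_dvd (revp_srlift k q') (size_srlift k q').
  have : h * mrevp n h %| srlift k q'.
    rewrite Gauss_dvdp ?h_dvd // irreducible_poly_coprime //.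
    apply: contra ntl => h_dvd'; apply/eqP/esym.
    by apply: irreducible_monic_dvd; rewrite ?(mrevp_monic n h0).
  have lq0 : srlift k q' != 0 by rewrite -size_fgt0 size_srliftE.
  move=> /(dvdp_fleq lq0); rewrite size_srliftE //.
  by case: (mul_mrevp mh sh h0) => _ -> _; lia.
have : h %| srlift n g by rewrite Eg dvdp_mulr.
move: gn0; rewrite Eqr mulf_eq0 negb_or.
case/andP=> [/[dup] q0 /size_pos_pred[k sq] /[dup] r0 /size_pos_pred[m sr]].
have -> : n = (k + m)%N by move: sg; rewrite Eqr size_fmul // sq sr; lia.
rewrite srliftM ?sq ?sr // => /(irreducible_dvdM irr_h)/orP[hq|hr]; [right|left].
  by rewrite -sr; apply: (big q r); rewrite ?sq.
by rewrite -sq; apply: (big r q); rewrite ?sr // mulrC.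
Qed.

(** Take a monic irreducible factor h of the lift. Either h = h~ or h h~ divides the lift; in each
    case [srlift_sym_factor] makes this symmetric factor the whole lift, and the first case
    contradicts reducibility. *)
Lemma srlift_reducible n g : (1 < n)%N -> irreducible_poly g -> g \is monic -> size g = n.+1 ->
  ~ irreducible_poly (srlift n g) ->
  exists h, [/\ irreducible_poly h, h \is monic, size h = n.+1, mrevp n h != h
    & srlift n g = h * mrevp n h].
Proof.
move=> lt1n irr_g mg sg nirr; have [ml sl] := srlift_monic mg sg.
have [|h [irr_h mh h_dvd]] := @irreducible_factor (srlift n g); first by rewrite sl; lia.
have [k sh] := size_pos_pred (monic_neq0 mh).
have h0 : h`_0 != 0.
  apply: contraTneq h_dvd => h0; apply/negP => /dvdpP[e /(congr1 (fun p : {poly F} => p`_0))].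
  by rewrite coef0M h0 mulr0 srlift_coef0 (monic_coef mg) // => /eqP; rewrite oner_eq0.
(* A linear h would have a nonzero root a, and (a^2 + 1) / a would be a root of g, impossible in
   degree n > 1. *)
have k_gt1 : (1 < k)%N.
  have := (irr_fsize irr_h); rewrite sh ltnS => k_gt0; rewrite ltn_neqAle k_gt0 andbT.
  apply/negP => /eqP k1; have [a h_a] : {a | root h a} by apply: poly2_root; rewrite sh -k1.
  have a0 : a != 0 by apply: contraNneq h0 => a0; rewrite -horner_coef0; rewrite a0 in h_a.
  have : root (srlift n g) a.
    by rewrite -dvdp_XsubCl (dvdp_trans _ h_dvd) // dvdp_XsubCl.
  rewrite /root horner_srlift ?sg // mulf_eq0 (negbTE (expf_neq0 _ a0)) /=.
  exact/negP/(irreducible_root _ irr_g sg).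
have [fix_h|ntl] := eqVneq (mrevp k h) h.
  have [sym_h even_k] := mrevp_fixed irr_h mh sh k_gt1 fix_h.
  case: nirr; rewrite -(@srlift_sym_factor n g k./2 h) ?even_halfK //.
  by rewrite half_gt0.
have [mp sp sym_p] := mul_mrevp mh sh h0.
have Ep : h * mrevp k h = srlift n g.
  apply: srlift_sym_factor sp _ _ _ => //; first by lia.
  rewrite Gauss_dvdp ?h_dvd ?(mrevp_dvd mh sh h0 h_dvd (revp_srlift n g)) ?size_srlift //.
  rewrite irreducible_poly_coprime //; apply: contra ntl => h_dvd'; apply/eqP/esym.
  by apply: irreducible_monic_dvd; rewrite ?(mrevp_monic k h0) //; apply: mrevp_irreducible.
have Ekn : k = n by move: sp; rewrite Ep sl; lia.
by rewrite Ekn in sh ntl Ep; exists h; split.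
Qed.

Lemma mul_mrevp_inj n h h' : irreducible_poly h -> h \is monic -> size h = n.+1 ->
  irreducible_poly h' -> h' \is monic -> size h' = n.+1 -> h'`_0 != 0 ->
  h * mrevp n h = h' * mrevp n h' -> h = h' \/ h = mrevp n h'.
Proof.
move=> irr_h mh sh irr_h' mh' sh' h'0 E.
have : h %| h' * mrevp n h' by rewrite -E dvdp_mulr.
case/(irreducible_dvdM irr_h)/orP=> /irreducible_monic_dvd H; [left|right]; apply: H => //.
  exact: mrevp_irreducible.
by rewrite mrevp_monic.
Qed.

End Reciprocal.

(** * Coefficient vectors and the maps [phi] and [psi] *)

Section Counting.
Variable F : finFieldType.
Implicit Types (f g h p q : {poly F}) (n d l m k : nat).

Lemma coef_mkmonic d (u : {ffun 'I_d -> F}) (i : 'I_d) : (mkmonic u)`_i = u i.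
Proof.
rewrite coefD coefXn ltn_eqF // add0r coef_sumMXn (bigD1 i) //= big1 ?addr0 //.
by move=> j /andP[/eqP/val_inj-> /eqP].
Qed.

Lemma mkmonic_size_monic d (u : {ffun 'I_d -> F}) :
  ((mkmonic u \is monic) * (size (mkmonic u) = d.+1))%type.
Proof.
have sum0 k : (d <= k)%N -> (\sum_(i < d) u i *: 'X^i)`_k = 0.
  move=> le_dk; rewrite coef_sumMXn big_pred0 // => i /=.
  by rewrite ltn_eqF // (leq_trans (ltn_ord i)).
apply: size_monic => [|]; last by rewrite coefD coefXn eqxx sum0 ?addr0.
by apply/leq_sizeP => k lt_dk; rewrite coefD coefXn gtn_eqF // sum0 ?addr0 // ltnW.
Qed.

Lemma mkmonic_monic d (u : {ffun 'I_d -> F}) : mkmonic u \is monic.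
Proof. exact: (mkmonic_size_monic u).1. Qed.

Lemma size_mkmonic d (u : {ffun 'I_d -> F}) : size (mkmonic u) = d.+1.
Proof. exact: (mkmonic_size_monic u).2. Qed.

(** Besides producing the vectors b, [lows d] inverts [mkmonic] on monic polynomials of degree
    [d]. *)
Definition lows t f : {ffun 'I_t -> F} := [ffun i : 'I_t => f`_i].
Definition tops l d f : {ffun 'I_l -> F} := [ffun i : 'I_l => topc f d i.+1].

Lemma mkmonicK d : cancel (@mkmonic F d) (lows d).
Proof. by move=> u; apply/ffunP => i; rewrite ffunE coef_mkmonic. Qed.

Lemma lowsK d f : f \is monic -> size f = d.+1 -> mkmonic (lows d f) = f.
Proof.
move=> mf sf; apply/polyP => i; have [lt_id|] := ltnP i d.
  by rewrite -[i]/(val (Ordinal lt_id)) coef_mkmonic ffunE.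
rewrite leq_eqVlt => /predU1P[<-|lt_di].
  by rewrite !monic_coef // ?mkmonic_monic ?size_mkmonic.
by rewrite !nth_default ?sf ?size_mkmonic.
Qed.

Lemma topcE f d j : topc f d j = (revp d f)`_j.
Proof. by rewrite coef_revp. Qed.

Lemma self_reciprocalE f d : size f = d.+1 -> self_reciprocal f = (revp d f == f).
Proof.
move=> sf; rewrite /self_reciprocal /recip sf; congr (_ == _).
by apply/polyP => i; rewrite coef_poly coef_revp ltnS.
Qed.

Lemma get_tops l d f k : (0 < k <= l)%N -> get (tops l d f) k = (revp d f)`_k.
Proof.
case: k => // k /= lt_kl; rewrite /get insubT /= ffunE topcE //.
Qed.

Lemma gg_tops l d f k : f \is monic -> size f = d.+1 -> (k <= l)%N ->
  gg (tops l d f) k = (revp d f)`_k.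
Proof.
rewrite /gg; case: eqP => [->|/eqP k0] mf sf le_kl; last by rewrite get_tops ?lt0n ?k0.
by rewrite coef_revp subn0 (monic_coef mf sf).
Qed.

Lemma getb_lows t f k : (k < t)%N -> getb (lows t f) k = f`_k.
Proof. by move=> lt_kt; rewrite /getb insubT /= ffunE. Qed.

(** As h h~ is symmetric, its top coefficients can be read at the low end, as a convolution of h~_j
    = a_j / b_0 with b. The extreme terms j = 0 and j = k give b_k / b_0 and a_k. *)
Lemma psi_tops l n h : h \is monic -> size h = n.+1 -> h`_0 != 0 ->
  psi (lows l.+1 h) (tops l n h) = tops l n.*2 (h * mrevp n h).
Proof.
move=> mh sh h0; apply/ffunP => i; rewrite !ffunE /= topcE; have lt_il := ltn_ord i.
have [_ _ ->] := mul_mrevp mh sh h0.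
rewrite [h * _]mulrC coefM; pose G j := (mrevp n h)`_j * h`_(i.+1 - j).
rewrite (_ : \sum_(j < i.+2) _ = \sum_(0 <= j < i.+2) G j) /G; last by rewrite big_mkord.
rewrite [in RHS]big_ltn // [in RHS]big_nat_recr // subn0 subnn.
rewrite !coefZ coef_revp subn0 leq0n (monic_coef mh sh).
rewrite get_tops // getb_lows //.
have -> : \sum_(1 <= j < i.+1) (mrevp n h)`_j * h`_(i.+1 - j) =
    (h`_0)^-1 * \sum_(1 <= j < i.+1) get (tops l n h) j * getb (lows l.+1 h) (i.+1 - j).
  rewrite mulr_sumr; apply: eq_big_nat => j /andP[j_gt0 lt_ji].
  by rewrite get_tops ?getb_lows ?coefZ ?mulrA //; lia.
by rewrite mulr1 [_^-1 * _ * h`_0]mulrAC mulVf // mul1r /=; ring.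
Qed.

Lemma sum_ord_widen (V : nmodType) m k (G : nat -> V) : (forall j, (m <= j)%N -> G j = 0) ->
  \sum_(j < m + k) G j = \sum_(j < m) G j.
Proof.
move=> G0; rewrite big_split_ord /= [X in _ + X]big1 ?addr0 // => j _.
by rewrite G0 // leq_addr.
Qed.

(** The indicator kills all j beyond k/2 and the binomial all j beyond d. A range independent of d
    is what allows the sums to be exchanged in [phi_tops]. *)
Lemma coef_XnX21 m d k M : (k./2 < M)%N ->
  ('X^m * ('X^2 + 1) ^+ d : {poly F})`_k = \sum_(j < M) ((m + 2 * j)%N == k)%:R * 'C(d, j)%:R.
Proof.
move=> lt_kM; pose G j : F := ((m + 2 * j)%N == k)%:R * 'C(d, j)%:R.
rewrite -(@sum_ord_widen _ M d.+1 G) => [|j le_Mj]; last first.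
  by rewrite /G (_ : _ == k = false) ?mul0r //; apply/eqP; lia.
rewrite addnC (@sum_ord_widen _ d.+1 M G) => [|j lt_dj]; last first.
  by rewrite /G bin_small ?mulr0.
rewrite addrC exprDn mulr_sumr coef_sum; apply: eq_bigr => j _.
by rewrite expr1n mul1r -exprM mulrnAr -exprD coefMn coefXn eq_sym /G mulr_natr.
Qed.

Lemma phi_tops l n g : g \is monic -> size g = n.+1 ->
  phi n (tops l n g) = tops l n.*2 (srlift n g).
Proof.
move=> mg sg; apply/ffunP => i; rewrite !ffunE /= topcE revp_srlift; have lt_il := ltn_ord i.
set k := i.+1; rewrite -[uphalf i]/(k./2) /srlift /homog coef_sum.
rewrite [RHS](reindex_inj rev_ord_inj) [RHS]/=.
under [RHS]eq_bigr => m _.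
  rewrite subSS subKn ?leq_ord // coefZ (@coef_XnX21 _ _ _ k./2.+1) // mulr_sumr.
over.
rewrite exchange_big /=; apply: eq_bigr => j _; have lt_jk := ltn_ord j.
have le_jk : (2 * j <= k)%N by lia.
rewrite gg_tops //; last by lia.
(* When k - 2j > n the subtraction inside the binomial may be truncated, but its cofactor is then 0,
   and no m <= n satisfies m + 2j = k. *)
rewrite coef_revp; case: leqP => [le_kn|lt_nk].
  have lt_kn : (k - 2 * j < n.+1)%N by [].
  rewrite (bigD1 (Ordinal lt_kn)) //= big1 => [|m neq_m].
    by rewrite addr0 subnK // eqxx mul1r mulrC; congr (_ * 'C(_, _)%:R); lia.
  rewrite (_ : _ == k = false) ?mul0r ?mulr0 //; apply: contraNF neq_m => /eqP E.
  by apply/eqP/val_inj => /=; lia.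
rewrite mulr0 big1 // => m _; have := leq_ord m => le_mn.
by rewrite (_ : _ == k = false) ?mul0r ?mulr0 //; apply/eqP; lia.
Qed.

(** Each coordinate of the image is a_i plus a function of the earlier coordinates, so [a] can be
    recovered one coordinate after another. *)
Lemma unitriangular_inj l (phi : {ffun 'I_l -> F} -> {ffun 'I_l -> F}) :
    (forall (a a' : {ffun 'I_l -> F}) (i : 'I_l), (forall j : 'I_l, (j < i)%N -> a j = a' j) ->
      phi a i - a i = phi a' i - a' i) ->
  injective phi.
Proof.
move=> phiP a a' eq_phi; apply/ffunP => i.
have [k] := ubnP (val i); elim: k i => // k IHk i le_ik.
have /(phiP a a' i) : forall j : 'I_l, (j < i)%N -> a j = a' j.
  by move=> j lt_ji; apply: IHk; apply: leq_trans lt_ji _.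
by rewrite eq_phi => /addrI/oppr_inj.
Qed.

Lemma get_eq l (a a' : {ffun 'I_l -> F}) k k' :
  (forall j : 'I_l, (j < k)%N -> a j = a' j) -> (k' <= k)%N -> get a k' = get a' k'.
Proof.
move=> eq_a le_k'k; rewrite /get; case: insubP => // j _ Ej.
case: k' le_k'k Ej => // k' lt_k'k /= Ej.
by rewrite eq_a // Ej.
Qed.

Lemma get_ord l (a : {ffun 'I_l -> F}) (i : 'I_l) : get a i.+1 = a i.
Proof. by rewrite /get /= insubT //= => lt_il; congr (a _); apply: val_inj. Qed.

Lemma psi_inj l (b : {ffun 'I_l.+1 -> F}) : injective (psi b).
Proof.
apply: unitriangular_inj => a a' i eq_a; rewrite !ffunE /= !get_ord.
rewrite (eq_big_nat _ _ (F2 := fun j => get a' j * getb b (i.+1 - j))).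
  ring.
by move=> j /andP[_ lt_ji]; rewrite (get_eq eq_a).
Qed.

Lemma phi_inj l n : injective (@phi F n l).
Proof.
(* The summand j = 0 is the coordinate itself; the others involve only smaller indices k - 2j. *)
apply: unitriangular_inj => a a' i eq_a; rewrite !ffunE /= !big_ord_recl /= !bin0 !mul1r.
rewrite !muln0 !subn0 /gg /= !get_ord addrAC subrr add0r [RHS]addrAC subrr add0r.
apply: eq_bigr => j _; congr (_ * _); case: eqP => // _.
by rewrite (get_eq eq_a) //= /bump /=; lia.
Qed.

(** An injective self-map of a finite type is onto, so [pick] succeeds and the default [c] in
    [phiinv] and [psiinv] is never reached. *)
Lemma pick_inv (T : finType) (phi : T -> T) (c a : T) : injective phi ->
  (a == odflt c [pick g | phi g == c]) = (phi a == c).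
Proof.
move=> phi_inj; case: pickP => [g /eqP<-|no] /=; first by rewrite (inj_eq phi_inj).
by have [phi' _ phiK] := injF_bij phi_inj; have := no (phi' c); rewrite phiK eqxx.
Qed.

Lemma topsE l d f (a : {ffun 'I_l -> F}) :
  [forall i : 'I_l, topc f d i.+1 == a i] = (tops l d f == a).
Proof.
by apply/forallP/eqP => [E|<- i]; [apply/ffunP => i; rewrite ffunE; apply/eqP | rewrite ffunE].
Qed.

Lemma lowsE t f (b : {ffun 'I_t -> F}) : [forall i : 'I_t, f`_i == b i] = (lows t f == b).
Proof.
by apply/forallP/eqP => [E|<- i]; [apply/ffunP => i; rewrite ffunE; apply/eqP | rewrite ffunE].
Qed.

(** * The count for a fixed target vector *)

Section Fixed.
Variables (l n : nat) (c : {ffun 'I_l -> F}).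
Hypothesis n_gt1 : (1 < n)%N.
Implicit Types (u w : {ffun 'I_n -> F}).

(** With g and h coded by [u] and [w], [T u] is the lift of g and [P w] is h h~. [D] singles out the
    g with irreducible lift, [Hs] the h equal to h~. *)
Let irr d (u : {ffun 'I_d -> F}) := `[< irreducible_poly (mkmonic u) >].
Let T u := srlift n (mkmonic u).
Let P w := mkmonic w * mrevp n (mkmonic w).
Let A := [set u | irr u && (tops l n.*2 (T u) == c)].
Let D := [set u | `[< irreducible_poly (T u) >]].
Let H := [set w | irr w && (tops l n.*2 (P w) == c)].
Let Hs := [set w : {ffun 'I_n -> F} | mrevp n (mkmonic w) == mkmonic w].

Let mk := mkmonic_monic.
Let sk := size_mkmonic.

Lemma irr_coef0 w : irr w -> (mkmonic w)`_0 != 0.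
Proof. by move=> /asboolP irr_w; apply: irreducible_coef0 irr_w _ n_gt1. Qed.

Lemma Icount_srlift : Icount n (phiinv n c) = #|A|.
Proof.
apply: eq_card => u; rewrite !inE topsE -/(irr u); congr (_ && _).
rewrite pick_inv ?phi_tops //; exact: phi_inj.
Qed.

(** Lifting is injective, and every self-reciprocal monic irreducible of degree 2n is the lift of an
    irreducible g. *)
Lemma Scount_srlift : Scount n c = #|A :&: D|.
Proof.
pose e u := lows n.*2 (T u).
have eK u : mkmonic (e u) = T u by rewrite lowsK // srlift_monic.
rewrite -(@card_in_imset _ _ e) => [|u u' _ _ /(congr1 (@mkmonic F _))]; last first.
  by rewrite !eK => /srlift_inj; rewrite !sk => /(_ (leqnn _) (leqnn _))/(can_inj (@mkmonicK n)).
apply: eq_card => v; rewrite inE topsE (self_reciprocalE (sk v)).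
apply/idP/imsetP => [/andP[/andP[/eqP sym_v /asboolP irr_v] top_v]|[u]].
  have [g [mg sg] Eg] := srlift_monic_surj (mk v) (sk v) sym_v.
  have Eu : mkmonic (lows n g) = g by rewrite lowsK.
  exists (lows n g); last by rewrite /e /T Eu Eg mkmonicK.
  rewrite !inE /irr /T Eu Eg top_v andbT; apply/andP; split; apply/asboolP => //.
  by apply: srlift_irreducible_imp sg _; rewrite ?Eg // ltnW.
rewrite !inE => /andP[/andP[_ top_u] irr_u ->].
by rewrite eK top_u irr_u /T revp_srlift eqxx.
Qed.

(** [H] is partitioned by the low-order vector b of h, whose b_0 is nonzero by irreducibility in
    degree n > 1. For fixed b, [psi_tops] turns the condition on h h~ into one on the top
    coefficients of h. *)
Lemma sum_Icount2 :
  (\sum_(b : {ffun 'I_l.+1 -> F} | (b ord0 != 0)%R) Icount2 n (psiinv b c) b)%N = #|H|.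
Proof.
rewrite -sum1_card (partition_big (fun w => lows l.+1 (mkmonic w)) (fun b => b ord0 != 0)) /=.
  apply: eq_bigr => b b0; rewrite /Icount2 -sum1_card; apply: eq_bigl => w.
  rewrite !inE topsE lowsE -/(irr w) -!andbA; congr (_ && _).
  case: (lows _ _ =P b) => [Eb|]; rewrite ?andbF // !andbT pick_inv; last exact: psi_inj.
  by rewrite -Eb psi_tops //; move: b0; rewrite -Eb ffunE.
by move=> w; rewrite inE ffunE => /andP[/irr_coef0].
Qed.

(** An irreducible h = h~ is self-reciprocal, so its low-order vector is (1, a) with a its top
    vector; the set is partitioned by a. *)
Lemma sum_Shalf : (\sum_(a : {ffun 'I_l -> F}) (psi (cons1 a) a == c) * Shalf n a)%N = #|H :&: Hs|.
Proof.
have fixP w : irr w -> w \in Hs -> revp n (mkmonic w) = mkmonic w /\ ~~ odd n.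
  by move=> /asboolP irr_w; rewrite inE => /eqP; apply: mrevp_fixed.
have symP w : revp n (mkmonic w) = mkmonic w ->
    [/\ (mkmonic w)`_0 = 1, w \in Hs & lows l.+1 (mkmonic w) = cons1 (tops l n (mkmonic w))].
  move=> sym_w; have w0 : (mkmonic w)`_0 = 1.
    by rewrite -(coef_sym sym_w (leq0n n)) subn0 (monic_coef (mk w)).
  split=> //; first by rewrite inE /mrevp w0 invr1 scale1r sym_w.
  apply/ffunP => j; rewrite !ffunE; case: eqP => [-> //|/eqP j0].
  by rewrite get_tops ?sym_w // lt0n j0 -ltnS ltn_ord.
(* For odd n no irreducible h = h~ exists, which matches the value 0 of [Shalf]. *)
rewrite /Shalf; case: (boolP (odd n)) => [odd_n|even_n].
  rewrite big1 => [|a _]; last by rewrite muln0.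
  apply/esym/eqP; rewrite cards_eq0; apply/set0Pn => -[w /setIP[]].
  by rewrite inE => /andP[irr_w _] /(fixP w irr_w)[_]; rewrite odd_n.
have -> : (\sum_(a : {ffun 'I_l -> F}) (psi (cons1 a) a == c) * Scount n./2 a =
   \sum_(a : {ffun 'I_l -> F} | psi (cons1 a) a == c)
    #|[set w : {ffun 'I_n -> F} | (revp n (mkmonic w) == mkmonic w) && irr w
         && (tops l n (mkmonic w) == a)]|)%N.
  rewrite [RHS]big_mkcond; apply: eq_bigr => a _; case: ifP; rewrite ?mul0n ?mul1n // => _.
  (* [Scount n./2] ranges over vectors of length [n./2.*2], which is n by evenness. *)
  rewrite -[in RHS](even_halfK even_n); apply: eq_card => v.
  by rewrite !inE topsE (self_reciprocalE (sk v)).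
rewrite -sum1_card (partition_big (fun w => tops l n (mkmonic w))
  (fun a => psi (cons1 a) a == c)) /=.
  apply: eq_bigr => a psi_a; rewrite -sum1_card; apply: eq_bigl => w.
  rewrite [LHS]inE; case: (tops _ _ _ =P a) => [Ea|]; rewrite ?andbF // !andbT.
  apply/andP/setIP => [[/eqP sym_w irr_w]|[]].
    have [w0 w_s low_w] := symP w sym_w; split=> //.
    by rewrite inE irr_w -psi_tops ?w0 ?oner_eq0 // low_w Ea.
  by rewrite inE => /andP[irr_w _] /(fixP w irr_w)[-> _].
move=> w /setIP[]; rewrite inE => /andP[irr_w /eqP<-] /(fixP w irr_w)[/symP[w0 _ <-] _].
by rewrite psi_tops ?w0 ?oner_eq0.
Qed.

(* Count the pairs [(u, w)] with [T u = P w]: each [w] has one partner, each [u] has two. *)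
Lemma card_nonsym : (#|A :\: D| * 2 = #|H :\: Hs|)%N.
Proof.
have mkI := can_inj (@mkmonicK n).
transitivity (\sum_(u in A :\: D) \sum_(w in H :\: Hs | T u == P w) 1)%N.
  rewrite -sum_nat_const; apply: eq_bigr => u; rewrite !inE.
  case/andP=> /asboolPn nirr /andP[/asboolP irr_u top_u].
  have [h [irr_h mh sh ntl Eu]] := srlift_reducible n_gt1 irr_u (mk u) (sk u) nirr.
  have h0 := irreducible_coef0 irr_h sh n_gt1.
  have [mt st] := mrevp_monic n h0; have irr_t := mrevp_irreducible mh sh h0 irr_h.
  (* The partners of [u] are exactly h and h~, which are distinct. *)
  rewrite sum1_card -(_ : #|[set lows n h; lows n (mrevp n h)]| = 2%N); last first.
    rewrite cards2 (_ : _ != _) //; apply: contra ntl => /eqP/(congr1 (@mkmonic F n)).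
    by rewrite !lowsK // => {1}<-.
  apply: eq_card => w; rewrite [RHS]unfold_in /= !inE; apply/orP/andP.
    have Pt : mrevp n h * mrevp n (mrevp n h) = T u by rewrite mrevpK // mulrC.
    case=> /eqP->; rewrite /irr /P !lowsK //.
      by rewrite -Eu ntl top_u eqxx andbT; split=> //; apply/asboolP.
    by rewrite Pt mrevpK // top_u eqxx eq_sym ntl andbT; split=> //; apply/asboolP.
  case=> /andP[_ /andP[/asboolP irr_w _]] /eqP E.
  have := mul_mrevp_inj irr_w (mk w) (sk w) irr_h mh sh h0.
  rewrite -/(P w) -E => /(_ Eu)[] Ew; [left|right]; apply/eqP/mkI; by rewrite lowsK.
rewrite (exchange_big_dep (mem (H :\: Hs))) /=; last by move=> u w _ /andP[].
rewrite -sum1_card.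
apply: eq_bigr => w; rewrite !inE => /andP[ntl /andP[/[dup] irr_w0 /asboolP irr_w top_w]].
have w0 := irr_coef0 irr_w0.
have [mp sp sym_p] := mul_mrevp (mk w) (sk w) w0.
(* The only partner of [w] is the preimage g of the symmetric product h h~. *)
have [g [mg sg] Eg] := srlift_monic_surj mp sp sym_p.
have irr_g := srlift_mul_mrevp_irreducible (ltnW n_gt1) sg irr_w (mk w) (sk w) w0 ntl Eg.
have Eu : mkmonic (lows n g) = g by rewrite lowsK.
rewrite sum1_card -(cards1 (lows n g)); apply: eq_card => u.
rewrite [LHS]unfold_in /= !inE; apply/andP/eqP => [[_ /andP[_ /eqP E]]|->].
  by apply: mkI; rewrite Eu; apply: (@srlift_inj _ n); rewrite ?sk ?sg // Eg.
rewrite /T /irr Eu Eg -/(P w) -/(irr w) top_w ntl irr_w0 eqxx !andbT; split=> //.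
apply/andP; split; last exact/asboolP.
(* The lift of g is h h~ with both factors nonconstant, so g lies outside [D]. *)
apply/asboolPn => /irreducible_mulP[_ /(_ _ _ erefl)].
by rewrite mrevp_monic // sk; case=> -[] E; move: n_gt1; rewrite E.
Qed.

(** Doubling and moving the negative term across keeps the identity in [nat]. It follows by
    splitting [A] along [D] and [H] along [Hs] and comparing the complements by [card_nonsym]. *)
Lemma Scount_balance :
  (2 * Scount n c + \sum_(b : {ffun 'I_l.+1 -> F} | (b ord0 != 0)%R) Icount2 n (psiinv b c) b
   = \sum_(a : {ffun 'I_l -> F}) (psi (cons1 a) a == c) * Shalf n a
     + 2 * Icount n (phiinv n c))%N.
Proof.
rewrite sum_Shalf sum_Icount2 Icount_srlift Scount_srlift.
by rewrite -(cardsID D A) -[#|H|](cardsID Hs H) -card_nonsym; lia.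
Qed.

End Fixed.
End Counting.

Theorem theorem1 (F : finFieldType) (l n : nat) (c : {ffun 'I_l -> F}) :
  (1 < n)%N ->
  ((Scount n c)%:R : rat) =
    (1 / 2) * \sum_(a : {ffun 'I_l -> F})
                 (psi (cons1 a) a == c)%:R * (Shalf n a)%:R
    + (Icount n (phiinv n c))%:R
    - (1 / 2) * \sum_(b : {ffun 'I_l.+1 -> F} | b ord0 != 0)
                 (Icount2 n (psiinv b c) b)%:R.
Proof.
move=> n_gt1; under eq_bigr do rewrite -natrM.
rewrite -!natr_sum; have := Scount_balance c n_gt1.
move=> /(congr1 (fun m : nat => m%:R : rat)); rewrite natrD natrM [RHS]natrD [in RHS]natrM; lra.
Qed.
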